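(* Every $T_3$ and countably compact $\Delta$-space is compact.
   Context: A topological space $X$ is a $\Delta$-space (written $X\in\Delta$) if for every decreasing sequence $\{A_n : n<\omega\}$ of subsets of $X$ (i.e. $A_{n+1}\subset A_n$ for all $n$) with $\bigcap_{n<\omega}A_n=\emptyset$ there is a (decreasing) sequence $\{U_n : n<\omega\}$ of open subsets of $X$ with $\bigcap_{n<\omega}U_n=\emptyset$ and $A_n\subset U_n$ for all $n<\omega$. $T_3$ means regular and $T_1$. Countably compact means every countable open cover has a finite subcover; compact means every open cover has a finite subcover. *)

(* Defs.v *)
From mathcomp Require Import all_boot all_classical.
From mathcomp Require Import topology.

Set Implicit Arguments.
Unset Strict Implicit.
Unset Printing Implicit Defensive.

Local Open Scope classical_set_scope.

Definition Delta_space (X : topologicalType) : Prop :=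
  forall A : nat -> set X,
    (forall n, A n.+1 `<=` A n) -> \bigcap_n A n = set0 ->
  exists U : nat -> set X,
    [/\ forall n, open (U n),
        forall n, U n.+1 `<=` U n,
        \bigcap_n U n = set0 &
        forall n, A n `<=` U n].

(* [regular_space] alone does not include the T1 axiom. *)
Definition T3_space (X : topologicalType) : Prop :=
  regular_space X /\ accessible_space X.

(* [cover_compact] with the index set of the cover restricted to be countable
   (finite allowed). *)
Definition countably_compact (X : topologicalType) (A : set X) : Prop :=
  forall (I : choiceType) (D : set I) (f : I -> set X),
    countable D -> (forall i, D i -> open (f i)) -> A `<=` cover D f ->
  finite_subset_cover D f A.

(* Main.v *)
Require Import Defs.
From mathcomp Require Import all_boot finmap all_classical.
From mathcomp Require Import topology.

Local Open Scope classical_set_scope.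

(** The heart of the proof is that, for a countably compact subset [Y] of a
Delta-space, every open cover of [Y] with at most continuum many members has a
finite subcover ([small_cover_finite]).  Given a cover without one, extend it
by Zorn's lemma to a maximal family [J] of open sets of which no finite part
covers [Y], and call a set null if countably many members of [J] cover its
trace on [Y].  Null sets form a sigma-ideal, proper because [Y] is countably
compact.  By maximality an open set containing a non-null set has a null
complement; so if open sets contain the terms of a sequence of non-null sets,
their intersection has a null complement too and cannot be empty.  The
Delta-property therefore forbids decreasing sequences of non-null sets with
empty intersection.  Halving non-null sets again and again would yield such a
sequence, so some non-null [A] admits only trivial splittings modulo null
sets: the ideal restricted to [A] is the dual of a sigma-complete ultrafilter.
Such an ultrafilter decides countably many bits at once, hence every map from
[A] to the Cantor space is constant up to a null set.  Applied to (a code of)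
the choice, for each point, of a member of the cover containing it, this says
that a single member contains almost all of [A]; but members of the cover are
null.

Two applications finish the argument.  In a regular space, the closure of a
countable set has, for each open cover, a refinement indexed by the subsets of
the countable set; so closures of countable sets are compact
([separable_compact]).  Now suppose that some open cover of the space has no
finite subcover.  Closures of countable sets lie in finite unions of members,
and countably many such unions never exhaust the space.  Closing off under
both facts by a recursion over countably branching trees yields continuum many
points such that the union [E] of the closures of their countable subsets is
covered by continuum many of these open unions, no countable part of which
suffices.  Yet [E] is countably compact, because countably many countable sets
fit in one, whose closure is compact: this contradicts the first result. *)

(** * Calculus of finite subcovers *)

Lemma finite_subset_coverP {T : Type} {I : choiceType} (D : set I)
    (f : I -> set T) (A : set T) :
  finite_subset_cover D f A <->
  exists E, [/\ finite_set E, E `<=` D & A `<=` cover E f].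
Proof.
split=> [[D' D'D AD']|[E [finE ED AE]]].
  exists [set` D']; split=> // i iD'.
  exact/set_mem/D'D.
exists (fset_set E) => [i|]; last by rewrite fset_setK.
by rewrite in_fset_set // => /set_mem /ED /mem_set.
Qed.

Lemma finite_subset_cover_trans {T : Type} {I J : choiceType} (D : set I)
    (f : I -> set T) (D' : set J) (g : J -> set T) (A : set T) :
  finite_subset_cover D f A ->
  (forall i, D i -> finite_subset_cover D' g (A `&` f i)) ->
  finite_subset_cover D' g A.
Proof.
move=> /finite_subset_coverP[E [finE ED AE]] fD.
have /choice[F FP] : forall i, exists F, D i ->
    [/\ finite_set F, F `<=` D' & A `&` f i `<=` cover F g].
  move=> i; have [/fD/finite_subset_coverP[F ?]|?] := pselect (D i).
    by exists F.
  by exists set0.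
apply/finite_subset_coverP; exists (\bigcup_(i in E) F i); split.
- by apply: bigcup_finite => // i /ED/FP[].
- by move=> j [i /ED/FP[_ + _]]; apply.
- move=> x Ax; have [i Ei fix_] := AE x Ax.
  have [_ _ /(_ x (conj Ax fix_))[j Fj gj]] := FP i (ED _ Ei).
  by exists j => //; exists i.
Qed.

Lemma finite_subset_cover1 {T : Type} {I : choiceType} (D : set I)
    (f : I -> set T) (i : I) (A : set T) :
  D i -> A `<=` f i -> finite_subset_cover D f A.
Proof.
move=> Di Afi; apply/finite_subset_coverP; exists [set i]; split=> //.
- by move=> _ ->.
- by move=> x /Afi fx; exists i.
Qed.

Lemma finite_subset_cover_sub {T : Type} {I : choiceType} (D : set I)
    (f : I -> set T) (A B : set T) :
  A `<=` B -> finite_subset_cover D f B -> finite_subset_cover D f A.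
Proof. by move=> AB [E ED BE]; exists E => // x /AB/BE. Qed.

Lemma finite_subset_cover0 {T : Type} {I : choiceType} (D : set I)
    (f : I -> set T) : finite_subset_cover D f set0.
Proof. by apply/finite_subset_coverP; exists set0; split. Qed.

Lemma finite_subset_coverS {T : Type} {I : choiceType} (D D' : set I)
    (f : I -> set T) (A : set T) :
  D `<=` D' -> finite_subset_cover D f A -> finite_subset_cover D' f A.
Proof.
move=> DD' /finite_subset_coverP[E [fE ED AE]].
by apply/finite_subset_coverP; exists E; split=> // i /ED/DD'.
Qed.

(** Finite subcovers being finite objects, a subcover drawn from the union of
a chain of families is drawn from one of them; this is what makes Zorn's lemma
applicable.  The chain may be empty, whence the first alternative. *)
Lemma finite_subset_cover_chain {T : Type} (O : set (set T))
    (F : set (set (set T))) (A : set T) :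
  total_on F subset ->
  finite_subset_cover (O `|` \bigcup_(J in F) J) id A ->
  finite_subset_cover O id A \/
  exists2 J, F J & finite_subset_cover (O `|` J) id A.
Proof.
move=> Ftot [D D_sub AD].
have h (s : seq (set T)) : {subset s <= O `|` \bigcup_(J in F) J} ->
    {subset s <= O} \/ exists2 J, F J & {subset s <= O `|` J}.
  elim: s => [_|U s IH sub]; first by left.
  have {IH}[sO|[J FJ sJ]] : {subset s <= O} \/
      exists2 J, F J & {subset s <= O `|` J}.
    by apply: IH => V Vs; apply: sub; rewrite in_cons Vs orbT.
  - have /set_mem[OU|[J FJ JU]] := sub U (mem_head _ _).
      by left=> V; rewrite in_cons => /predU1P[->|/sO//]; apply/mem_set.
    right; exists J => // V; rewrite in_cons => /predU1P[->|/sO/set_mem OV];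
      apply/mem_set; [by right|by left].
  - right; have /set_mem[OU|[K FK KU]] := sub U (mem_head _ _).
      exists J => // V; rewrite in_cons => /predU1P[->|/sJ//].
      by apply/mem_set; left.
    have [JK|KJ] := Ftot J K FJ FK.
      exists K => // V; rewrite in_cons => /predU1P[->|/sJ/set_mem[?|/JK?]];
        apply/mem_set; by [left|right].
    exists J => // V; rewrite in_cons => /predU1P[->|/sJ//].
    by apply/mem_set; right; apply: KJ.
have [DO|[J FJ DJ]] := h _ D_sub; [left|right; exists J => //]; by exists D.
Qed.

(** * Atoms of ideals *)

(** Here [N] is an ideal of null sets.  Were every non-null set divisible into
two non-null pieces, one could keep halving the whole set: the remainders [R n]
decrease and each [R n] minus the limit contains the non-null piece discarded
at stage [n], so the sets [R n] minus the limit would be a forbidden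
sequence. *)
Lemma atom_of_vanishing {T : Type} (N : set (set T)) :
  (forall A B, A `<=` B -> N B -> N A) ->
  (forall A : nat -> set T, (forall n, A n.+1 `<=` A n) ->
    \bigcap_n A n = set0 -> exists n, N (A n)) ->
  ~ N setT ->
  exists2 A, ~ N A & forall B, N (A `&` B) \/ N (A `\` B).
Proof.
move=> Nsub Nvan NT; apply: contrapT => noatom.
have /choice[g gP] : forall A, exists B,
    ~ N A -> ~ N (A `&` B) /\ ~ N (A `\` B).
  move=> A; apply: contrapT => /forallNP h; apply: noatom; exists A.
    by move=> NA; apply: (h set0).
  move=> B; apply: contrapT => /not_orP nB; exact: (h B).
pose R := fix R n := if n is n'.+1 then R n' `&` g (R n') else setT.
have Rpos n : ~ N (R n) by elim: n => //= n /gP[].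
have [n||n] := Nvan (fun n => R n `\` \bigcap_k R k).
- by move=> x [[Rx _] nx].
- by rewrite -subset0 => x h; have [_] := h 0 I; apply=> n _; have [] := h n I.
- have [_ +] := gP _ (Rpos n); apply: contra_not; apply: Nsub.
  by move=> x [Rx gx]; split=> // /(_ n.+1 I)[].
Qed.

(** A sigma-complete two-valued measure on [A] decides each of the countably
many coordinates of [h], and the countably many exceptional sets add up to a
null set. *)
Lemma conull_fiber {T : Type} (N : set (set T)) (A : set T)
    (h : T -> nat -> bool) :
  (forall A B, A `<=` B -> N B -> N A) ->
  (forall A : nat -> set T, (forall n, N (A n)) -> N (\bigcup_n A n)) ->
  (forall B, N (A `&` B) \/ N (A `\` B)) ->
  exists b, N (A `&` [set x | h x <> b]).
Proof.
move=> Nsub NU Aatom.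
have /choice[b bP] : forall n, exists b, N (A `&` [set x | h x n <> b]).
  move=> n; have [NB|NB] := Aatom [set x | h x n].
    exists false; apply: Nsub NB => x [Ax /= hx]; split=> //=.
    by case: (h x n) hx.
  exists true; apply: Nsub NB => x [Ax /= hx]; split=> //=.
exists b; apply: Nsub (NU _ bP) => x [Ax /= hx].
have /existsNP[n hn] : ~ forall n, h x n = b n by move=> e; apply/hx/funext.
by exists n.
Qed.

(** * Covers by at most continuum many open sets *)

Lemma maximal_noncover {X : topologicalType} (O : set (set X)) (Y : set X) :
  O `<=` open -> ~ finite_subset_cover O id Y ->
  exists J, [/\ O `<=` J, J `<=` open, ~ finite_subset_cover J id Y &
    forall U, open U -> J U \/ finite_subset_cover J id (Y `\` U)].
Proof.
move=> Oopen OY.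
pose P J := J `<=` @open X /\ ~ finite_subset_cover (O `|` J) id Y.
have [F FP Ftot|J [[Jopen JY] Jmax]] := @Zorn_bigcup (set X) P.
  split; first by move=> U [J /FP[+ _] JU]; apply.
  by move=> /(finite_subset_cover_chain _ _ _ Ftot)[//|[J /FP[]]].
exists (O `|` J); split=> //; first by move=> U [/Oopen|/Jopen].
move=> U oU; have [OJU|nU] := pselect ((O `|` J) U); [by left|right].
have : ~ P (U |` J).
  apply: Jmax; split; last first.
    by move=> /(_ U (or_introl erefl)) JU; apply: nU; right.
  by move=> V ?; right.
move=> /not_andP[|/contrapT /finite_subset_coverP[E [finE ED YE]]].
  by case=> V [->//|/Jopen].
apply/finite_subset_coverP; exists (E `\` [set U]); split.
- exact: finite_setD.
- by move=> V [/ED[OV _|[VU /(_ VU)//|JV _]]]; [left|right].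
- by move=> x [/YE[V EV Vx] nUx]; exists V => //; split=> // VU;
  apply: nUx; rewrite -VU.
Qed.

(** The map [code] bounds the cardinality of the index type by that of the
continuum. *)
Lemma small_cover_finite {X : topologicalType} (I : Type)
    (code : I -> nat -> bool) (O : I -> set X) (Y : set X) :
  Delta_space X -> countably_compact Y -> injective code ->
  (forall i, open (O i)) -> Y `<=` \bigcup_i O i ->
  finite_subset_cover (range O) id Y.
Proof.
move=> DX ccY code_inj oO YO; apply: contrapT => noO.
have [|J [OJ Jopen JY Jmax]] := maximal_noncover (range O) Y _ noO.
  by move=> _ [i _ <-].
pose N : set (set X) := [set A | exists D,
  [/\ countable D, D `<=` J & A `&` Y `<=` cover D id]].
have Nsub A B : A `<=` B -> N B -> N A.
  by move=> AB [D [cD DJ BD]]; exists D; split=> // x [/AB Bx Yx]; apply: BD.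
have NU (A : nat -> set X) : (forall n, N (A n)) -> N (\bigcup_n A n).
  move=> /choice[D DP]; exists (\bigcup_n D n); split.
  - by apply: bigcup_countable => // n _; have [] := DP n.
  - by move=> U [n _ DU]; have [_ + _] := DP n; apply.
  - move=> x [[n _ Ax] Yx]; have [_ _ /(_ x (conj Ax Yx))[U DU Ux]] := DP n.
    by exists U => //; exists n.
have N1 U : J U -> N U.
  move=> JU; exists [set U]; split=> //; first by move=> _ ->.
  by move=> x [Ux _]; exists U.
have NT : ~ N setT.
  move=> [D [cD DJ +]]; rewrite setTI => YD; apply: JY.
  by apply: (finite_subset_coverS _ _ _ _ DJ); apply: ccY => // U /DJ/Jopen.
(* By maximality of [J], an open set that is not in [J] covers [Y] together
   with finitely many members of [J]. *)
have Nopen A U : open U -> A `<=` U -> ~ N A -> N (~` U).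
  move=> oU AU NA; have [/N1/(Nsub _ _ AU)//|] := Jmax U oU.
  move=> /finite_subset_coverP[E [finE EJ YE]]; exists E; split=> //.
    exact: finite_set_countable.
  by move=> x [nU Yx]; apply: YE.
have Nvan (A : nat -> set X) : (forall n, A n.+1 `<=` A n) ->
    \bigcap_n A n = set0 -> exists n, N (A n).
  move=> Adec A0; apply: contrapT => /forallNP Apos.
  have [U [oU _ U0 AU]] := DX A Adec A0; apply: NT.
  rewrite -setC0 -U0 setC_bigcap; apply: NU => n.
  exact: Nopen (oU n) (AU n) (Apos n).
have [A Apos Aatom] := atom_of_vanishing N Nsub Nvan NT.
have /choice[h hP] : forall x, exists b, Y x -> exists2 i, O i x & code i = b.
  move=> x; have [/YO[i _ Oix]|nY] := pselect (Y x).
    by exists (code i), i.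
  by exists (fun=> true).
have [b Nb] := conull_fiber N A h Nsub NU Aatom.
(* The fiber of [h] over [b] lies in a single member of [J], or is empty. *)
apply: Apos; suff [U JU YU] : exists2 U, J U & Y `&` [set x | h x = b] `<=` U.
  have : N (\bigcup_n (if n is 0 then A `&` [set x | h x <> b] else U)).
    by apply: NU => -[//|n]; apply: N1.
  move=> [D [cD DJ DU]]; exists D; split=> // x [Ax Yx]; apply: DU; split=> //.
  by have [hb|hb] := pselect (h x = b); [exists 1 => //; apply: YU|exists 0].
have [[x [Yx hx]]|/forallNP no] := pselect (exists x, Y x /\ h x = b).
  have [i _ ib] := hP x Yx; exists (O i); first by apply: OJ; exists i.
  move=> y [Yy hy]; have [j Ojy jb] := hP y Yy.
  by rewrite (code_inj i j) // ib jb hx -hy.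
exists set0; last by move=> x [Yx hx]; case: (no x).
by have [//|] := Jmax set0 open0; rewrite setD0 => /JY.
Qed.

(** * Closures of countable sets *)

Lemma countably_compact_closed {X : topologicalType} (K : set X) :
  countably_compact [set: X] -> closed K -> countably_compact K.
Proof.
move=> ccX clK I D f cD fo KD.
have [->|/set0P[k Kk]] := eqVneq K set0; first exact: finite_subset_cover0.
have [i0 Di0 _] := KD k Kk.
(* Adding the complement of [K] to every member, rather than as a new member,
   keeps the index set; this needs a member, hence the case [K = set0]. *)
apply: (finite_subset_cover_trans D (fun i => f i `|` ~` K)).
  apply: finite_subset_cover_sub (@subsetT _ K) _; apply: ccX => //.
    by move=> i Di; apply: openU (fo i Di) (closed_openC clK).
  move=> x _; have [/KD[i Di fx]|nKx] := pselect (K x).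
    by exists i => //; left.
  by exists i0 => //; right.
by move=> i Di; apply: (finite_subset_cover1 _ _ i) => // x [Kx []].
Qed.

(** With a dense sequence [s], send [b] to the complement [tr b] of the closure
of the points [s n] with [b n] false.  On the closure [K] of the sequence,
[tr b] stays within the closure of the points [s n] with [b n] true.  Hence if
[V] is an open neighbourhood whose closure lies in a member of the cover and
[b] is the trace of [V] on [s], then [tr b] contains [V] while its part in [K]
lies in that member: the sets [tr b] contained on [K] in some member form a
refinement indexed by the Cantor space. *)
Lemma separable_compact {X : topologicalType} (s : nat -> X) :
  T3_space X -> countably_compact [set: X] -> Delta_space X ->
  cover_compact (closure (range s)).
Proof.
move=> [regX _] ccX DX I D f fo KD.
set K := closure _ in KD *.
have ccK : countably_compact K.
  by apply: countably_compact_closed => //; apply: closed_closure.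
pose tr (b : nat -> bool) := ~` closure (s @` [set n | ~~ b n]).
pose O b :=
  if `[< exists2 i, D i & K `&` tr b `<=` f i >] then tr b else set0.
apply: (finite_subset_cover_trans (range O) id).
  apply: (small_cover_finite _ id) => //.
  - move=> b; rewrite /O; case: asboolP => _; last exact: open0.
    by apply: closed_openC; apply: closed_closure.
  - move=> x Kx; have [i Di fix_] := KD x Kx.
    have /regX[V0 /= nV0 V0f] : nbhs x (f i).
      by apply: open_nbhs_nbhs; split=> //; apply: fo.
    move: nV0; rewrite nbhsE => -[V [oV Vx] VV0].
    pose b n := `[< V (s n) >]; exists b => //.
    have trx : tr b x.
      move=> /(_ V)[|y [[n /= /asboolPn nVn <-] //]].
      exact: open_nbhs_nbhs.
    rewrite /O; case: asboolP => // -[]; exists i => // y [Ky try].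
    apply/V0f/(closureS VV0); apply: (closureS (A := s @` [set n | b n])).
      by move=> _ [n /asboolP Vn <-].
    have : closure (s @` [set n | b n] `|` s @` [set n | ~~ b n]) y.
      apply: closureS Ky => _ [n _ <-].
      by case bn: (b n); [left|right]; exists n => //=; rewrite bn.
    by rewrite closureU => -[].
move=> _ [b _ <-]; rewrite /O; case: asboolP => [[i Di Kf]|_].
  exact: finite_subset_cover1 Di Kf.
by rewrite setI0; apply: finite_subset_cover0.
Qed.

(** * Closing off under countable operations *)

(** Well-founded countably branching trees: names for everything obtained from
a starting point by iterating operations on sequences.  They play the role of
the countable ordinals, and of the bookkeeping, in a transfinite recursion of
length omega_1. *)
Inductive ctree := Leaf | Node of (nat -> ctree).

(** The codes show that there are at most continuum many trees, so that the
cover they index falls under [small_cover_finite]. *)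
Fixpoint ctree_code (t : ctree) : nat -> bool :=
  if t is Node c then
    fun k => if k is k'.+1 then
      let ij := odflt (0, 0) (choice.unpickle k') in ctree_code (c ij.1) ij.2
    else true
  else fun=> false.

Lemma ctree_code_inj : injective ctree_code.
Proof.
elim=> [|c IH] [|d] //=.
- by move=> /(congr1 (@^~ 0)).
- by move=> /(congr1 (@^~ 0)).
- move=> e; congr Node; apply/funext => i; apply: IH; apply/funext => j.
  have := congr1 (@^~ (choice.pickle (i, j)).+1) e.
  by rewrite /= choice.pickleK.
Qed.

(** Points and open sets are built together because each new point must avoid
the open sets already present, while each new open set must absorb the limits
of the points already present. *)
Fixpoint escape_tree {X : Type} (x0 : X) (nb : (nat -> X) -> set X)
    (escape : (nat -> set X) -> X) (t : ctree) : X * set X :=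
  if t is Node c then
    (escape (fun n => (escape_tree x0 nb escape (c n)).2),
     nb (fun n => (escape_tree x0 nb escape (c n)).1))
  else (x0, set0).

(** If no finite part of a countable cover were enough, points witnessing the
failure of the first [n] members, for all [n], would come from countably many
of the closures; merging the countably many sequences into one puts all these
points in a single compact closure, where finitely many members suffice. *)
Lemma omega_union_countably_compact {X : topologicalType} {T : Type}
    (p : T -> X) :
  (forall c : nat -> T, cover_compact (closure (range (p \o c)))) ->
  countably_compact (\bigcup_(c : nat -> T) closure (range (p \o c))).
Proof.
set E := \bigcup_c _ => Kcpt I D f cD fo ED; apply: contrapT => noE.
have /countable_injP[e e_inj] := cD.
have /choice[yc ycP] : forall n, exists yc : X * (nat -> T),
    closure (range (p \o yc.2)) yc.1 /\
    forall i, D i -> e i < n -> ~ f i yc.1.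
  move=> n; apply: contrapT => /forallNP h; apply: noE.
  apply/finite_subset_coverP; exists (D `&` e @^-1` `I_n); split.
  - apply: (@sub_finite_set _ _ (\bigcup_(k in `I_n) (D `&` e @^-1` [set k]))).
      by move=> i [Di ien]; exists (e i).
    apply: bigcup_finite (finite_II n) _ => k _.
    have [->|/set0P[i [Di eik]]] := eqVneq (D `&` e @^-1` [set k]) set0 => //.
    apply: sub_finite_set (finite_set1 i) => j [Dj ejk].
    by apply: e_inj; rewrite ?inE // eik ejk.
  - by move=> i [].
  - move=> y [c _ cy]; apply: contrapT => ny; apply: (h (y, c)).
    by split=> // i Di ien fiy; apply: ny; exists i.
(* The [m]-th term of the [n]-th sequence becomes the term of index
   [pickle (n, m)] of the merged one. *)
pose c n := let ij := odflt (0, 0) (choice.unpickle n) in (yc ij.1).2 ij.2.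
have Ky n : closure (range (p \o c)) (yc n).1.
  have [+ _] := ycP n; apply: closureS => _ [m _ <-].
  by exists (choice.pickle (n, m)) => //=; rewrite /c choice.pickleK.
have [|D' D'D KD'] := Kcpt c I D f fo.
  by move=> y Kcy; apply: ED; exists c.
pose n := (\max_(i <- D') e i).+1.
have [i iD' fiy] := KD' _ (Ky n).
have [_ /(_ i)] := ycP n; apply=> //; first exact/set_mem/D'D.
by rewrite ltnS; apply: leq_bigmax_seq.
Qed.

(** * Countable compactness and compactness *)

Theorem theorem2p3 (X : topologicalType) :
  T3_space X -> countably_compact [set: X] -> Delta_space X ->
  cover_compact [set: X].
Proof.
move=> T3X ccX DX I D f fo XD; apply: contrapT => noX.
have sepK s := @separable_compact X s T3X ccX DX.
(* Bounded open sets: those that finitely many members of the cover cover. *)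
pose B V := open V /\ finite_subset_cover D f V.
have /choice[nb nbP] : forall s : nat -> X, exists V,
    closure (range s) `<=` V /\ B V.
  move=> s; have [|D' D'D KD'] := sepK s I D f fo.
    by move=> x _; apply: XD.
  exists (cover [set` D'] f); split=> //; split; last by exists D'.
  by apply: bigcup_open => i iD'; apply/fo/set_mem/D'D.
have escapeP (V : nat -> set X) :
    (forall n, B (V n)) -> exists x, forall n, ~ V n x.
  move=> BV; apply: contrapT => /forallNP h; apply: noX.
  apply: (@finite_subset_cover_trans _ _ _ setT V).
    apply: ccX => [|n _|x _]; [exact: countableP|by case: (BV n)|].
    by have /existsNP[n /contrapT Vnx] := h x; exists n.
  by move=> n _; rewrite setTI; case: (BV n).
have B0 : B set0 by split; [exact: open0|exact: finite_subset_cover0].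
have [x0 _] := escapeP (fun=> set0) (fun=> B0).
have /choice[escape escapeV] : forall V : nat -> set X, exists x,
    (forall n, B (V n)) -> forall n, ~ V n x.
  move=> V; have [/escapeP[x ?]|?] := pselect (forall n, B (V n)).
    by exists x.
  by exists x0.
pose build := escape_tree x0 nb escape.
pose pt t := (build t).1; pose op t := (build t).2.
have Bop t : B (op t) by case: t => [//|c]; have [] := nbP (pt \o c).
have ptN c n : ~ op (c n) (pt (Node c)).
  by apply: (escapeV (op \o c)) => m; apply: Bop.
have opN c : closure (range (pt \o c)) `<=` op (Node c).
  by have [] := nbP (pt \o c).
have ccE := @omega_union_countably_compact X ctree pt (fun c => sepK (pt \o c)).
set E := \bigcup_c _ in ccE.
have [|c|x [c _ cx]|F FO EF] :=
  small_cover_finite _ (ctree_code \o Node) (op \o Node) E DX ccE.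
- by move=> c d /ctree_code_inj[].
- by case: (Bop (Node c)).
- by exists c => //; apply: opN.
have /choice[g gP] : forall U, exists c, U \in F -> op (Node c) = U.
  move=> U; have [/FO/set_mem[c _ cU]|UF] := boolP (U \in F); first by exists c.
  by exists (fun=> Leaf).
(* A node whose children name all members of the finite family [F] names a
   point of [E] outside all of them. *)
pose c n := Node (g (nth set0 F n)).
have [|U /= UF] := EF (pt (Node c)).
  by exists (fun=> Node c) => //; apply: subset_closure; exists 0.
rewrite -(gP U UF) -(nth_index set0 UF); exact: ptN.
Qed.
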